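(* Let $G$ be a noncomplete graph. Then $\overline{e}pa(G) \leq \overline{E}pa(G) \leq 5$. Moreover: (i) $\overline{E}pa(G) = 5$ if and only if there are nonadjacent (distinct) vertices $u$ and $v$ of $G$ with $\gamma(G-\{u,v\}) = \gamma(G)-2$. (ii) $\overline{e}pa(G) = 5$ if and only if $G$ is edgeless. (iii) $\overline{e}pa(G) = \overline{E}pa(G) = 4$ if and only if for each pair $u,v$ of nonadjacent (distinct) vertices of $G$, $\gamma(G-\{u,v\}) \geq \gamma(G)-1$ and at least one of the following holds: (a) $u \in V^-(G)$ and $v$ is a $\gamma$-good vertex of $G-u$; (b) $v \in V^-(G)$ and $u$ is a $\gamma$-good vertex of $G-v$.
   Context: Graphs are finite and simple. $\gamma(H)$ denotes the domination number of a graph $H$, with $\gamma=0$ for the graph with no vertices; a $\gamma$-set of $H$ is a dominating set of $H$ of cardinality $\gamma(H)$. A vertex of $H$ is a $\gamma$-good vertex of $H$ if it belongs to some $\gamma$-set of $H$. $V^-(H) = \{x \in V(H) \mid \gamma(H-x) < \gamma(H)\}$. For distinct vertices $u,v$ of $G$ and an integer $k\geq 0$, $G_{u,v,k}$ denotes the graph obtained from the disjoint union of $G$ and a path $x_0,x_1,\dots,x_{k+1}$ by identifying $u$ with $x_0$ and $v$ with $x_{k+1}$ (so $k$ new vertices are added; for nonadjacent $u,v$, $G_{u,v,0}$ is $G$ with the edge $uv$ added). $pa(u,v)$ is the minimum integer $k\geq 0$ such that $\gamma(G) < \gamma(G_{u,v,k})$. $\overline{e}pa(G)$ and $\overline{E}pa(G)$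 are, respectively, the minimum and the maximum of $pa(u,v)$ over all pairs of distinct nonadjacent vertices $u,v$ of $G$. *)

(* Defs.v *)
From mathcomp Require Import all_boot.

Set Implicit Arguments.
Unset Strict Implicit.
Unset Printing Implicit Defensive.

Record sgraph := SGraph {
  vertex :> finType;
  adj : rel vertex;
  adj_sym : symmetric adj;
  adj_irrefl : irreflexive adj }.

Definition complete (G : sgraph) : bool :=
  [forall x : G, forall y : G, (x != y) ==> adj x y].

Definition edgeless (G : sgraph) : bool :=
  [forall x : G, forall y : G, ~~ adj x y].

Definition nonadjacent (G : sgraph) (u v : G) : bool :=
  (u != v) && ~~ adj u v.

Section Domination.
Variable H : sgraph.

Definition dominating (D : {set H}) : bool :=
  [forall x, (x \in D) || [exists y in D, adj x y]].

Lemma dominating_setT : dominating [set: H].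
Proof. by apply/forallP => x; rewrite inE. Qed.

Definition gamma : nat := #|[arg min_(D < [set: H] | dominating D) #|D|]|.

Lemma gamma_min (D : {set H}) : dominating D -> gamma <= #|D|.
Proof.
by rewrite /gamma; case: arg_minnP => [|D0 _ min_D0]; [exact: dominating_setT | exact: min_D0].
Qed.

Lemma gamma_attained : exists2 D : {set H}, dominating D & #|D| = gamma.
Proof.
rewrite /gamma; case: arg_minnP => [|D dom_D _]; first exact: dominating_setT.
by exists D.
Qed.

Definition gamma_set (D : {set H}) : bool := dominating D && (#|D| == gamma).

Definition gamma_good (x : H) : bool := [exists D : {set H}, gamma_set D && (x \in D)].

End Domination.

Section Deletion.
Variables (G : sgraph) (S : {set G}).

Definition del_adj : rel {x : G | x \notin S} := fun x y => adj (val x) (val y).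

Fact del_sym : symmetric del_adj.
Proof. by move=> x y; rewrite /del_adj adj_sym. Qed.

Fact del_irrefl : irreflexive del_adj.
Proof. by move=> x; rewrite /del_adj adj_irrefl. Qed.

(* The graph G - S, induced by the vertices outside S. *)
Definition del : sgraph := SGraph del_sym del_irrefl.

(* A vertex v of G is a gamma-good vertex of G - S; in particular v is
   required to be a vertex of G - S. *)
Definition gamma_good_del (v : G) : Prop :=
  exists2 x : del, val x = v & gamma_good x.

End Deletion.

Definition Vminus (H : sgraph) : {set H} :=
  [set x : H | gamma (del [set x]) < gamma H].

Section AddPath.
Variables (G : sgraph) (u v : G) (k : nat).

(* The vertices of G_{u,v,k} are those of G together with the k internal
   vertices of the path, where inr i stands for x_{i+1}. *)
Definition path_vertex (i : 'I_k.+2) : G + 'I_k :=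
  if (i : nat) is j.+1 then
    if insub j is Some j' then inr j' else inl v
  else inl u.

Definition path_edge (a b : G + 'I_k) : bool :=
  [exists i : 'I_k.+2, exists j : 'I_k.+2,
    [&& j == i.+1 :> nat, path_vertex i == a & path_vertex j == b]].

Definition old_edge (a b : G + 'I_k) : bool :=
  match a, b with inl x, inl y => adj x y | _, _ => false end.

(* The conjunct a != b only matters in the junk case u = v, k = 0. *)
Definition add_path_adj : rel (G + 'I_k)%type := fun a b =>
  (a != b) && [|| old_edge a b, path_edge a b | path_edge b a].

Fact add_path_sym : symmetric add_path_adj.
Proof.
move=> a b; rewrite /add_path_adj eq_sym [path_edge a b || _]orbC.
by case: a b => [x|i] [y|j] //=; rewrite adj_sym.
Qed.

Fact add_path_irrefl : irreflexive add_path_adj.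
Proof. by move=> a; rewrite /add_path_adj eqxx. Qed.

Definition add_path : sgraph := SGraph add_path_sym add_path_irrefl.

Lemma path_vertexS (i : 'I_k.+2) (m : 'I_k) :
  path_vertex i = inr m -> i = m.+1 :> nat.
Proof.
rewrite /path_vertex; case: i => [[|i] lti] //=.
by case: insubP => [j' _ <- [->]|].
Qed.

Lemma add_path_adjP (a : G + 'I_k) (m : 'I_k) : 0 < m -> m.+1 < k ->
  add_path_adj (inr m) a -> exists2 m' : 'I_k, a = inr m' & m.-1 <= m' <= m.+1.
Proof.
move=> m0 mk /andP[_ /= /orP[]] /existsP[i /existsP[j /and3P[/eqP ij /eqP]]].
  move=> /path_vertexS im /eqP <-; rewrite /path_vertex ij im.
  case: insubP => [m' _ m'E|]; last by rewrite mk.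
  by exists m' => //; rewrite m'E leqnn andbT -subn1 (leq_trans (leq_subr _ _)).
move=> ia /eqP /path_vertexS jm; have im : i = m.-1.+1 :> nat.
  by apply/eqP; rewrite -eqSS -ij jm prednK.
move: ia; rewrite /path_vertex im.
case: insubP => [m' _ m'E <-|]; last by rewrite (leq_ltn_trans (leq_pred _)) //.
by exists m' => //; rewrite m'E leqnn (leq_trans (leq_pred _)).
Qed.

End AddPath.

Lemma pa_exists (G : sgraph) (u v : G) :
  exists k, gamma G < gamma (add_path u v k).
Proof.
set n := (gamma G).+1; exists (3 * n).
have [D /forallP dom_D <-] := gamma_attained (add_path u v (3 * n)).
pose f (a : G + 'I_(3 * n)) : nat := if a is inr m then m %/ 3 else 0.
have sub : {subset iota 0 n <= [seq f a | a in D]}.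
  move=> j; rewrite mem_iota /= add0n => ltjn.
  have lt_m : (3 * j).+1 < 3 * n.
    by apply: leq_trans (_ : 3 * j.+1 <= _); rewrite ?leq_mul2l // mulnS addnC addn3.
  have lt_m2 : (3 * j).+2 < 3 * n.
    by apply: leq_trans (_ : 3 * j.+1 <= _); rewrite ?leq_mul2l // mulnS addnC addn3.
  have fj (m' : nat) : 3 * j <= m' <= (3 * j).+2 -> m' %/ 3 = j.
    case/andP=> lo hi; rewrite -(subnKC lo) mulnC divnMDl // divn_small ?addn0 //.
    by rewrite ltn_subLR ?addn3 // mulnC.
  have /orP[mD | /existsP[a /andP[aD]]] := dom_D (inr (Ordinal lt_m)).
    by apply/imageP; exists (inr (Ordinal lt_m)); rewrite //= fj // !leqnSn.
  case/add_path_adjP=> //= m' am' bnd.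
  by apply/imageP; exists a; rewrite // am' /= fj.
have := uniq_leq_size (iota_uniq 0 n) sub.
by rewrite size_iota size_image.
Qed.

Definition pa (G : sgraph) (u v : G) : nat := ex_minn (pa_exists u v).

(* Maximum and minimum of pa over the pairs of distinct nonadjacent vertices;
   both are meaningful only when such a pair exists, i.e. when G is not
   complete. Starting the minimum from the maximum Epa G does not affect its
   value; see epa_attained. *)
Definition Epa (G : sgraph) : nat :=
  \max_(p : G * G | nonadjacent p.1 p.2) pa p.1 p.2.

Definition epa (G : sgraph) : nat :=
  \big[minn/Epa G]_(p : G * G | nonadjacent p.1 p.2) pa p.1 p.2.

Lemma noncompleteP (G : sgraph) :
  reflect (exists p : G * G, nonadjacent p.1 p.2) (~~ complete G).
Proof.
apply: (iffP idP) => [|[[u v] /= /andP[uv nadj]]].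
  rewrite negb_forall => /existsP[u]; rewrite negb_forall => /existsP[v].
  by rewrite negb_imply => uv; exists (u, v).
apply/negP => /forallP/(_ u)/forallP/(_ v).
by rewrite uv (negPf nadj).
Qed.

Lemma Epa_max (G : sgraph) (u v : G) : nonadjacent u v -> pa u v <= Epa G.
Proof.
by move=> uv; apply: (leq_bigmax_cond (F := fun p : G * G => pa p.1 p.2) (u, v)).
Qed.

Lemma Epa_attained (G : sgraph) : ~~ complete G ->
  exists2 p : G * G, nonadjacent p.1 p.2 & Epa G = pa p.1 p.2.
Proof.
case/noncompleteP=> p0 p0P.
by have [|p pP E] := eq_bigmax_cond (fun p : G * G => pa p.1 p.2)
  (A := [pred p | nonadjacent p.1 p.2]); [apply/card_gt0P; exists p0 | exists p].
Qed.

Lemma epa_min (G : sgraph) (u v : G) : nonadjacent u v -> epa G <= pa u v.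
Proof.
move=> uv; rewrite /epa; move: (mem_index_enum (u, v)).
elim: (index_enum _) => [|p r IHr] //; rewrite inE big_cons => /predU1P[<-|/IHr le_r].
  by rewrite uv geq_minl.
by case: ifP => // _; rewrite (leq_trans (geq_minr _ _)).
Qed.

Lemma epa_attained (G : sgraph) : ~~ complete G ->
  exists2 p : G * G, nonadjacent p.1 p.2 & epa G = pa p.1 p.2.
Proof.
move=> ncG; rewrite /epa.
elim/big_ind: _ => [|x y Hx Hy|p pP]; first exact: Epa_attained.
  by rewrite /minn; case: ifP.
by exists p.
Qed.

(* Main.v *)
(**
A dominating set of G_{u,v,k} amounts to a set A of vertices of G and a 0/1
pattern on the path: A dominates G except possibly u and v, and u (resp. v)
may be missed only when the adjacent vertex of the path is selected. Adding to
A those of u, v that it misses gives a dominating set of G. Enumerating the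
patterns for k = 5, 4, 3 then shows that
  - gamma(G_{u,v,5}) > gamma(G);
  - gamma(G_{u,v,4}) <= gamma(G) forces gamma(G-{u,v}) = gamma(G)-2;
  - gamma(G_{u,v,3}) <= gamma(G) forces that, or (a), or (b);
and each of these conditions conversely yields small dominating sets of
G_{u,v,k} for all smaller k as well.

For (ii), if gamma(G-{u,v}) = gamma(G)-2 then u and v have no common neighbour
w, since adding w would dominate both at once. Suppose this holds for all
nonadjacent pairs and let xy be an edge. Some v is not adjacent to x, as
otherwise x is a common neighbour of a nonadjacent pair. A minimum dominating
set A of G-{x,v} contains no neighbour of x, so y is dominated by some s in A;
then x and s are nonadjacent and share the neighbour y, a contradiction.
*)
Require Import Defs.
From mathcomp Require Import all_boot.
From mathcomp Require Import zify.

Set Implicit Arguments.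
Unset Strict Implicit.
Unset Printing Implicit Defensive.

(** * Domination and vertex deletion, expressed by sets of vertices of [G] *)

Section Covered.
Variable G : sgraph.
Implicit Types (A B S : {set G}) (u v x y : G).

(** Pointwise form of the condition in [dominating], so that sets dominating only part of the
    vertices can be handled inside [G]. *)
Definition covered A x := (x \in A) || [exists y in A, adj x y].

Lemma coveredP A x :
  reflect (x \in A \/ exists2 y, y \in A & adj x y) (covered A x).
Proof.
apply: (iffP orP) => -[xA|]; try by left.
  by case/existsP=> y /andP[yA xy]; right; exists y.
by case=> y yA xy; right; apply/existsP; exists y; rewrite yA.
Qed.

Lemma covered_mem A x : x \in A -> covered A x.
Proof. by rewrite /covered => ->. Qed.

Lemma coveredS A B x : A \subset B -> covered A x -> covered B x.
Proof.
move=> /subsetP sAB /coveredP[/sAB xB|[y /sAB yB xy]]; first exact: covered_mem.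
by apply/coveredP; right; exists y.
Qed.

Lemma gamma_leP n :
  reflect (exists2 A : {set G}, forall x, covered A x & #|A| <= n) (gamma G <= n).
Proof.
apply: (iffP idP) => [le_n|[A covA]].
  by have [A /forallP covA cardA] := gamma_attained G; exists A; rewrite ?cardA.
by apply: leq_trans; apply: gamma_min; apply/forallP.
Qed.

Lemma gamma_covered A : (forall x, covered A x) -> gamma G <= #|A|.
Proof. by move=> covA; apply/gamma_leP; exists A. Qed.

Lemma gamma_coveredU S A :
  (forall x, x \notin S -> covered A x) -> gamma G <= #|A :|: S|.
Proof.
move=> covA; apply: gamma_covered => x; have [xS|/covA] := boolP (x \in S).
  by apply: covered_mem; rewrite inE xS orbT.
exact: (coveredS (subsetUl _ _)).
Qed.

(** The booleans count as 0 or 1: only those of [u], [v] that [A] misses have to be added. *)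
Lemma gamma_covered2 u v A :
  (forall x, x != u -> x != v -> covered A x) ->
  gamma G <= #|A| + ~~ covered A u + ~~ covered A v.
Proof.
move=> covA; set B := [set x in [set u] | ~~ covered A x].
set C := [set x in [set v] | ~~ covered A x].
have cardB y : #|[set x in [set y] | ~~ covered A x]| <= ~~ covered A y.
  have [cy|ncy] := boolP (covered A y).
    rewrite leqn0 cards_eq0; apply/eqP/setP => x.
    by rewrite !inE; case: eqP => // ->; rewrite cy.
  rewrite /= -(cards1 y) subset_leq_card //.
  by apply/subsetP => x; rewrite inE => /andP[].
have /gamma_coveredU le : forall x, x \notin B :|: C -> covered A x.
  move=> x; apply: contraR => ncov; rewrite !inE ncov !andbT; apply/norP => -[xu xv].
  by rewrite covA in ncov.
apply: (leq_trans le); rewrite -addnA.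
apply: (leq_trans (leq_card_setU _ _)); rewrite leq_add2l.
by apply: (leq_trans (leq_card_setU _ _)); apply: leq_add; apply: cardB.
Qed.

Section Del.
Variable S : {set G}.

Lemma card_val_del (D : {set del S}) : #|val @: D| = #|D|.
Proof. by rewrite card_imset //; apply: val_inj. Qed.

Lemma val_del_notin (D : {set del S}) x : x \in S -> x \notin val @: D.
Proof. by move=> xS; apply/imsetP => -[z _ xz]; move: (valP z); rewrite -xz xS. Qed.

Lemma del_setE A : [disjoint A & S] -> exists D : {set del S}, A = val @: D.
Proof.
move=> dAS; exists (val @^-1: A); apply/setP => x; apply/idP/imsetP.
  move=> xA; have xS : x \notin S by rewrite (disjointFr dAS).
  by exists (exist _ x xS); rewrite ?inE.
by case=> z; rewrite inE => zA ->.
Qed.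

Lemma dominating_del (D : {set del S}) :
  dominating D <-> (forall x, x \notin S -> covered (val @: D) x).
Proof.
split=> [/forallP domD x xS|covD].
  have := domD (exist _ x xS) => /orP[xD|/existsP[y /andP[yD xy]]].
    by apply/coveredP; left; apply/imsetP; exists (exist _ x xS).
  by apply/coveredP; right; exists (val y) => //; apply: imset_f.
apply/forallP => x; apply/orP.
case/coveredP: (covD _ (valP x)) => [|[y]].
  by rewrite mem_imset; [left|apply: val_inj].
by case/imsetP=> z zD -> xz; right; apply/existsP; exists z; rewrite zD.
Qed.

Lemma gamma_del_leP n :
  (gamma (del S) <= n) <->
  exists A : {set G}, [/\ [disjoint A & S],
    forall x, x \notin S -> covered A x & #|A| <= n].
Proof.
split=> [le_n|[A [/del_setE[D ->]]]].
  have [D /dominating_del covD cardD] := gamma_attained (del S).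
  exists (val @: D); rewrite card_val_del cardD; split=> //.
  rewrite disjoint_sym disjoint_subset; apply/subsetP => x.
  exact: val_del_notin.
move/dominating_del/gamma_min; rewrite card_val_del; exact: leq_trans.
Qed.

Lemma gamma_del_ge : gamma G <= gamma (del S) + #|S|.
Proof.
have /gamma_del_leP[A [_ covA cardA]] := leqnn (gamma (del S)).
by rewrite (leq_trans (gamma_coveredU covA)) // (leq_trans (leq_card_setU _ _)) ?leq_add2r.
Qed.

End Del.

(** Deleting [u] lowers gamma by at most one, so a dominating set of [G - u] with fewer than
    [gamma G] vertices is automatically minimum there. *)
Lemma gamma_good_delP u v :
  (u \in Vminus G /\ gamma_good_del [set u] v) <->
  exists A : {set G}, [/\ v \in A, u \notin A,
    forall x, x != u -> covered A x & #|A| < gamma G].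
Proof.
split=> [[]|[A [vA uA covA cardA]]].
  rewrite inE => ltG [w <- /existsP[D /andP[/andP[domD /eqP cardD] wD]]].
  exists (val @: D); rewrite imset_f // val_del_notin ?set11 // card_val_del cardD.
  by split=> // x xu; move/dominating_del: domD; apply; rewrite inE.
have dA : [disjoint A & [set u]] by rewrite disjoint_sym disjoints1.
have [D AE] := del_setE dA; subst A.
have domD : dominating D by apply/dominating_del => x; rewrite inE; apply: covA.
have leD := gamma_min domD; rewrite card_val_del in cardA.
have := gamma_del_ge [set u]; rewrite cards1 => geD.
split; first by rewrite inE; apply: leq_ltn_trans cardA.
case/imsetP: vA => w wD ->; exists w => //; apply/existsP; exists D.
by rewrite /gamma_set domD wD andbT eqn_leq leD andbT; lia.
Qed.

End Covered.

(** * Dominating sets of [add_path u v k] as bit patterns *)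

Lemma card_set_sum (T1 T2 : finType) (D : {set T1 + T2}) :
  #|D| = #|[set x | inl x \in D]| + \sum_y (inr y \in D).
Proof.
rewrite -sum1_card big_mkcond big_sumType /= -!sum1_card [in RHS]big_mkcond /=.
by congr (_ + _); apply: eq_bigr => x _; rewrite ?inE //; case: (_ \in D).
Qed.

Section Path.
Variables (G : sgraph) (u v : G).
Hypothesis uv : u != v.

Lemma path_vertex_inl k (i : 'I_k.+2) (x : G) :
  path_vertex u v i = inl x ->
  (i = 0 :> nat /\ x = u) \/ (i = k.+1 :> nat /\ x = v).
Proof.
case: i => -[|i] lti; rewrite /path_vertex /=; first by case=> ->; left.
case: insubP => // ltik [->]; right; split=> //; lia.
Qed.

Lemma path_vertex_max k : path_vertex u v (ord_max : 'I_k.+2) = inl v.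
Proof. by rewrite /path_vertex /= insubF ?ltnn. Qed.

Lemma path_vertex_inr k (m : 'I_k) (i : 'I_k.+2) : i = m.+1 :> nat ->
  path_vertex u v i = inr m.
Proof.
by rewrite /path_vertex => ->; case: insubP => [m' _ /val_inj->|] //; rewrite ltn_ord.
Qed.

Lemma add_path_adj_step k (i j : 'I_k.+2) : j = i.+1 :> nat ->
  @adj (add_path u v k) (path_vertex u v i) (path_vertex u v j).
Proof.
move=> ij; apply/andP; split; last first.
  apply/or3P/Or32/existsP; exists i; apply/existsP; exists j.
  by rewrite ij !eqxx.
apply/eqP; case Ej: (path_vertex u v j) => [x|m] Ei.
  (* Consecutive path vertices both lie in [G] only for [k = 0], where they are [u] and [v]. *)
  have [] := path_vertex_inl Ei; have [] := path_vertex_inl Ej; try lia.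
  by case=> _ -> [_ /eqP]; rewrite eq_sym (negPf uv).
by have := path_vertexS Ei; have := path_vertexS Ej; lia.
Qed.

Lemma add_path_adjE k (a b : add_path u v k) : adj a b ->
  old_edge a b \/ exists i j : 'I_k.+2,
    [/\ path_vertex u v i = a, path_vertex u v j = b &
        j = i.+1 :> nat \/ i = j.+1 :> nat].
Proof.
case/andP=> _ /or3P[|/existsP[i /existsP[j]]|/existsP[i /existsP[j]]]; first by left.
  by case/and3P=> /eqP ij /eqP<- /eqP<-; right; exists i, j; split=> //; left.
by case/and3P=> /eqP ij /eqP<- /eqP<-; right; exists j, i; split=> //; right.
Qed.

(* [q i] tells whether the vertex x_i of the path is selected; the endpoints
   u = x_0 and v = x_(k+1) are counted in [A] only. *)
Definition path_pattern k (A : {set G}) (q : nat -> bool) :=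
  [/\ q 0 = (u \in A), q k.+1 = (v \in A),
      forall x, x != u -> x != v -> covered A x,
      (q 1 || covered A u) && (q k || covered A v) &
      forall i, i < k -> [|| q i, q i.+1 | q i.+2]].

(** The path meets [G] only in [u] and [v], so a set splits into its trace on [G] and bits on the
    path. For [k = 0] the bit [q 1] belongs to [v] and [q k] to [u], which accounts for the new
    edge. *)
Lemma gamma_add_path_leP k n :
  (gamma (add_path u v k) <= n) <->
  exists A q, path_pattern k A q /\ #|A| + \sum_(i < k) q i.+1 <= n.
Proof.
split=> [/gamma_leP[D covD cardD]|[A [q [[q0 qk covA /andP[q1 qk1] covq] cardA]]]].
  pose A := [set x : G | (inl x : add_path u v k) \in D].
  pose q i := (path_vertex u v (inord i : 'I_k.+2) : add_path u v k) \in D.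
  have qE (i : 'I_k.+2) : q i = (path_vertex u v i \in D) by rewrite /q inord_val.
  have qS (i : 'I_k) : q i.+1 = (inr i \in D).
    by rewrite /q (@path_vertex_inr _ i) ?inordK // !ltnS ltnW.
  (* A vertex of [G] missed by [A] is dominated along a path edge, so it must be an end of the
     path. *)
  have adjA (x : G) : x \notin A -> ~~ covered A x ->
      exists i j : 'I_k.+2, [/\ path_vertex u v i = inl x, q j &
        j = i.+1 :> nat \/ i = j.+1 :> nat].
    move=> xA ncov; have /coveredP[xD|[b bD]] := covD (inl x).
      by rewrite inE xD in xA.
    case/add_path_adjE=> [|[i [j [Ei Ej ij]]]].
      case: b bD => //= y yD xy; case/negP: ncov; apply/coveredP; right.
      by exists y; rewrite ?inE.
    by exists i, j; rewrite qE Ej.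
  exists A, q; split; last first.
    by rewrite (eq_bigr _ (fun i _ => congr1 nat_of_bool (qS i))) -card_set_sum.
  split.
  - by rewrite (qE ord0) inE.
  - by rewrite (qE ord_max) path_vertex_max inE.
  - move=> x xu xv; apply/negPn/negP => ncov.
    have [|i [j [/path_vertex_inl]]] := adjA x _ ncov.
      by apply: contra ncov; apply: covered_mem.
    by case=> -[_ xE]; move: xu xv; rewrite xE eqxx.
  - apply/andP; split; apply/orP; apply/orP; rewrite orbC -implyNb; apply/implyP => ncov.
      have [|i [j [/path_vertex_inl iu qj]]] := adjA u _ ncov.
        by apply: contra ncov; apply: covered_mem.
      case: iu => -[Ei]; last by move=> uvE; move: uv; rewrite uvE eqxx.
      by move=> _; rewrite Ei => -[jE|//]; rewrite -jE.
    have [|i [j [/path_vertex_inl iv qj]]] := adjA v _ ncov.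
      by apply: contra ncov; apply: covered_mem.
    case: iv => -[Ei]; first by move=> uvE; move: uv; rewrite uvE eqxx.
    move=> _ [jE|]; first by have := ltn_ord j; lia.
    by rewrite Ei => -[->].
  move=> i ltik; have [] := coveredP _ _ (covD (inr (Ordinal ltik))).
    by rewrite -qS => ->; rewrite orbT.
  case=> b bD /add_path_adjE[//|[i1 [j [/path_vertexS /= Ei Ej ij]]]].
  have qj : q j by rewrite qE Ej.
  case: ij => ij; first by rewrite Ei in ij; rewrite -ij qj !orbT.
  by move: ij; rewrite Ei => -[->]; rewrite qj.
pose D := [set a : add_path u v k | match a with inl x => x \in A | inr m => q m.+1 end].
have qE (i : 'I_k.+2) : q i = (path_vertex u v i \in D).
  case Ei: (path_vertex u v i) => [x|m]; last by rewrite inE (path_vertexS Ei).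
  by case: (path_vertex_inl Ei) => -[-> ->]; rewrite inE.
have covG (x : G) : covered A x -> covered D (inl x).
  case/coveredP => [xA|[y yA xy]]; apply/coveredP; [left|right].
    by rewrite inE.
  exists (inl y); first by rewrite inE.
  rewrite /= /add_path_adj /= xy andbT; apply/eqP => -[E].
  by rewrite E adj_irrefl in xy.
have step (i j : 'I_k.+2) : (j = i.+1 :> nat \/ i = j.+1 :> nat) -> q j ->
    covered D (path_vertex u v i).
  move=> ij; rewrite qE => jD; apply/coveredP; right; exists (path_vertex u v j) => //.
  by case: ij => ij; [|rewrite adj_sym]; apply: add_path_adj_step.
apply/gamma_leP; exists D; last first.
  rewrite card_set_sum; move: cardA; congr (_ + _ <= _).
    by apply: eq_card => x; rewrite !inE.
  by apply: eq_bigr => i _; rewrite inE.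
case=> [x|m].
  have [->|xu] := eqVneq x u.
    case/orP: q1 => [q1|/covG//].
    by apply: (step ord0 (inord 1)); rewrite inordK //; left.
  have [->|xv] := eqVneq x v; last by apply: covG; apply: covA.
  case/orP: qk1 => [qk1|/covG//]; rewrite -(path_vertex_max k).
  by apply: (step _ (inord k)); rewrite inordK //=; right.
have lt2 : m.+2 < k.+2 := ltn_ord m; have lt1 := ltnW lt2; have lt0 := ltnW lt1.
rewrite -(@path_vertex_inr _ m (inord m.+1)) ?inordK //.
case/or3P: (covq m (ltn_ord m)) => qm.
- by apply: (step _ (inord m)); rewrite !inordK //; right.
- by apply: covered_mem; rewrite -qE inordK.
by apply: (step _ (inord m.+2)); rewrite !inordK //; left.
Qed.


(** * Path lengths for which gamma does or does not grow *)

Definition pair_critical := gamma (del [set u; v]) + 2 = gamma G.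

Lemma gamma_del2_ge : gamma G <= gamma (del [set u; v]) + 2.
Proof. by have := gamma_del_ge [set u; v]; rewrite cards2 uv. Qed.

(** Deleting two vertices lowers gamma by at most two, so the inequality on [#|A|] already forces
    equality. *)
Lemma pair_criticalP :
  pair_critical <->
  exists A : {set G}, [/\ u \notin A, v \notin A,
    forall x, x != u -> x != v -> covered A x & #|A| + 2 <= gamma G].
Proof.
have ge2 := gamma_del2_ge; split=> [crit|[A [uA vA covA cardA]]].
  have /gamma_del_leP[A [dA covA cardA]] := leqnn (gamma (del [set u; v])).
  exists A; split.
  - by rewrite (disjointFl dA) // !inE eqxx.
  - by rewrite (disjointFl dA) // !inE eqxx orbT.
  - by move=> x xu xv; apply: covA; rewrite !inE (negPf xu).
  by rewrite -crit leq_add2r.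
suff : gamma (del [set u; v]) <= #|A| by rewrite /pair_critical; lia.
apply/gamma_del_leP; exists A; split=> // [|x].
  rewrite disjoint_sym disjoint_subset; apply/subsetP => x.
  by rewrite !inE => /orP[] /eqP->.
by rewrite !inE negb_or => /andP[]; apply: covA.
Qed.

(** Each end missed by [A] forces its own neighbour [x_1] or [x_5], and dominating [x_3] costs one
    more among [x_2], [x_3], [x_4]. Completing [A] inside [G] costs only one vertex per missed
    end. *)
Lemma gamma_add_path5 : gamma G < gamma (add_path u v 5).
Proof.
rewrite ltnNge; apply/negP => /gamma_add_path_leP[A [q [[q0 q6 covA cov_uv covq]]]].
have := gamma_covered2 covA; have /implyP := @covered_mem _ A u; have /implyP := @covered_mem _ A v.
rewrite -q0 -q6; move: cov_uv (covq 1 isT) (covq 2 isT) (covq 3 isT).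
move: (covq 0 isT) (covq 4 isT).
rewrite !big_ord_recl big_ord0 /=.
(* With all bits generalised, a finite check with linear arithmetic remains. *)
move: (q 0) (q 1) (q 2) (q 3) (q 4) (q 5) (q 6) (covered A u) (covered A v).
by clear covA covq q0 q6; do 9![case=> //=]; lia.
Qed.

(** The path may use at most one vertex per missed end. If [A] covered [u], a missed [v] would use
    up the budget on [x_4], yet dominating [x_2] costs another vertex; likewise with the ends
    exchanged. So both ends are missed, and [x_1], [x_4] cost two. *)
Lemma gamma_add_path4 : gamma (add_path u v 4) <= gamma G -> pair_critical.
Proof.
move/gamma_add_path_leP=> [A [q [[q0 q5 covA cov_uv covq] cardA]]].
suff : ~~ covered A u /\ ~~ covered A v /\ #|A| + 2 <= gamma G.
  case=> ncu [ncv leA]; apply/pair_criticalP; exists A; split=> //.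
    by apply: contra ncu; apply: covered_mem.
  by apply: contra ncv; apply: covered_mem.
move: cardA; have := gamma_covered2 covA.
have /implyP := @covered_mem _ A u; have /implyP := @covered_mem _ A v.
rewrite -q0 -q5; move: cov_uv (covq 0 isT) (covq 1 isT) (covq 2 isT) (covq 3 isT).
rewrite !big_ord_recl big_ord0 /=.
move: (q 0) (q 1) (q 2) (q 3) (q 4) (q 5) (covered A u) (covered A v).
by clear covA covq q0 q5; do 8![case=> //=]; lia.
Qed.

(** The budget is again one vertex per missed end, and dominating [x_2] needs at least one. If only
    [u] is missed, [x_1] is the sole choice, so [x_3] must be dominated by [v], whence [v \in A]. *)
Lemma gamma_add_path3 : gamma (add_path u v 3) <= gamma G ->
  [\/ pair_critical,
      u \in Vminus G /\ gamma_good_del [set u] v |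
      v \in Vminus G /\ gamma_good_del [set v] u].
Proof.
move/gamma_add_path_leP=> [A [q [[q0 q4 covA cov_uv covq] cardA]]].
suff : [\/ [/\ ~~ covered A u, ~~ covered A v & #|A| + 2 <= gamma G],
           [/\ v \in A, ~~ covered A u & #|A| < gamma G] |
           [/\ u \in A, ~~ covered A v & #|A| < gamma G]].
  case=> -[H1 H2 leA].
  - apply/Or31/pair_criticalP; exists A; split=> //.
      by apply: contra H1; apply: covered_mem.
    by apply: contra H2; apply: covered_mem.
  - apply/Or32/gamma_good_delP; exists A; split=> //.
      by apply: contra H2; apply: covered_mem.
    by move=> x xu; have [->|] := eqVneq x v; [apply: covered_mem|apply: covA].
  apply/Or33/gamma_good_delP; exists A; split=> //.
    by apply: contra H2; apply: covered_mem.
  by move=> x xv; have [->|xu] := eqVneq x u; [apply: covered_mem|apply: covA].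
move: cardA; have := gamma_covered2 covA.
have /implyP := @covered_mem _ A u; have /implyP := @covered_mem _ A v.
rewrite -q0 -q4; move: cov_uv (covq 0 isT) (covq 1 isT) (covq 2 isT).
rewrite !big_ord_recl big_ord0 /=.
move: (q 0) (q 1) (q 2) (q 3) (q 4) (covered A u) (covered A v).
(* Three selections survive, in this order: [x_0, x_3]; then [x_1, x_3]; then [x_1, x_4]. *)
clear covA covq q0 q4; do 7![case=> //=]; try lia; move=> *;
  [apply: Or33|apply: Or31|apply: Or32]; split=> //; lia.
Qed.

(** Two vertices may be spent beyond [A]. For [k <= 2] they are [u] and [v], since every new vertex
    is adjacent to one of them; for [k] equal to 3 or 4 they are [x_1] and [x_k]. *)
Lemma pair_critical_add_path k : k <= 4 -> pair_critical ->
  gamma (add_path u v k) <= gamma G.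
Proof.
move=> k4 /pair_criticalP[A [uA vA covA cardA]]; apply/gamma_add_path_leP.
have [k3|k3] := ltnP k 3.
  exists (u |: (v |: A)), (fun i => (i == 0) || (i == k.+1)); split.
    split; rewrite ?eqxx ?setU11 ?orbT //.
    - by rewrite !inE eqxx orbT.
    - move=> x xu xv; apply: coveredS (covA x xu xv).
      by rewrite setUA subsetUr.
    - by rewrite !covered_mem ?orbT // !inE eqxx ?orbT.
    by move=> i ik; apply/or3P; case: i ik => [|i] ik; [apply: Or31|apply: Or33; lia].
  rewrite big1 => [|i _]; last by rewrite /= eqSS (ltn_eqF (ltn_ord i)).
  rewrite addn0 !cardsU1; lia.
have {k3 k4}kE : k = 3 \/ k = 4 by lia.
exists A, (fun i => (i == 1) || (i == k)); split.
  case: kE => ->.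
    by split; rewrite ?(negPf uA) ?(negPf vA) //; case=> [|[|[]]].
  by split; rewrite ?(negPf uA) ?(negPf vA) //; case=> [|[|[|[]]]].
by case: kE => ->; rewrite !big_ord_recl big_ord0 /=; lia.
Qed.

Lemma good_add_path k : k <= 3 -> u \in Vminus G /\ gamma_good_del [set u] v ->
  gamma (add_path u v k) <= gamma G.
Proof.
move=> k3 /gamma_good_delP[A [vA uA covA cardA]]; apply/gamma_add_path_leP.
have [->|k_neq3] := eqVneq k 3.
  (* The one spare vertex is [x_1], dominating [u] and [x_2]. The bit at 4 is that of [v], which
     lies in [A] and dominates [x_3]. *)
  exists A, (fun i => (i == 1) || (i == 4)); split.
    split; rewrite ?(negPf uA) //=; last by case=> [|[|[]]].
      by move=> x xu _; apply: covA.
    by apply: covered_mem.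
  by rewrite !big_ord_recl big_ord0 /=; lia.
exists (u |: A), (fun i => (i == 0) || (i == k.+1)); split.
  split; rewrite ?eqxx ?setU11 ?orbT //.
  - by rewrite !inE vA orbT.
  - by move=> x xu _; apply: coveredS (covA x xu); rewrite subsetUr.
  - by rewrite !covered_mem ?orbT // !inE ?vA ?eqxx ?orbT.
  by move=> i ik; lia.
rewrite big1 => [|i _]; last by rewrite /= eqSS (ltn_eqF (ltn_ord i)).
by rewrite addn0 cardsU1 uA.
Qed.

End Path.

(** Reading the path backwards lets [good_add_path] serve alternative (b) as well as (a). *)
Lemma gamma_add_path_swap (G : sgraph) (u v : G) : u != v -> forall k,
  gamma (add_path u v k) <= gamma (add_path v u k).
Proof.
move=> uv k; have vu : v != u by rewrite eq_sym.
have /(gamma_add_path_leP vu)[A [q [[q0 qk covA cov_vu covq] cardA]]] :=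
  leqnn (gamma (add_path v u k)).
apply/(gamma_add_path_leP uv); exists A, (fun i => q (k.+1 - i)); split.
  split; rewrite ?subn0 ?subnn //.
  - by move=> x xu xv; apply: covA.
  - by rewrite andbC subSS subn0 subSnn.
  move=> i ik; have := covq (k - i.+1); rewrite !subSS.
  have -> : k.+1 - i = (k - i.+1).+2 by lia.
  have -> : k - i = (k - i.+1).+1 by lia.
  by move=> covqi; case/or3P: (covqi ltac:(lia)) => ->; rewrite ?orbT.
apply: leq_trans cardA; rewrite leq_add2l (reindex_inj rev_ord_inj) /=.
apply/eq_leq/eq_bigr => i _; congr (nat_of_bool (q _)).
by have := ltn_ord i; lia.
Qed.

(** * Large values of [pa] for a single pair *)

Lemma gt_pa (G : sgraph) (u v : G) m :
  (m < pa u v) <-> (forall k, k <= m -> gamma (add_path u v k) <= gamma G).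
Proof.
rewrite /pa; case: ex_minnP => p ltp min_p; split=> [mp k km|H].
  by rewrite leqNgt; apply/negP => /min_p; lia.
by rewrite ltnNge; apply/negP => /H; lia.
Qed.

Section Pa.
Variables (G : sgraph) (u v : G).
Hypothesis uv : u != v.

Lemma pa_le5 : pa u v <= 5.
Proof.
by rewrite leqNgt; apply/negP => /gt_pa/(_ 5 isT); rewrite leqNgt gamma_add_path5.
Qed.

Lemma pa_eq5P : pa u v = 5 <-> pair_critical u v.
Proof.
split=> [pa5|crit].
  have /gt_pa/(_ 4 isT) : 4 < pa u v by rewrite pa5.
  exact: gamma_add_path4.
(* As [pa] is a least value, the lower bound needs every length up to 4. *)
by apply/eqP; rewrite eqn_leq pa_le5; apply/gt_pa => k k4; apply: pair_critical_add_path.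
Qed.

End Pa.

Lemma gt3_paP (G : sgraph) (u v : G) : u != v ->
  3 < pa u v <->
  [\/ pair_critical u v,
      u \in Vminus G /\ gamma_good_del [set u] v |
      v \in Vminus G /\ gamma_good_del [set v] u].
Proof.
move=> uv; split=> [/gt_pa/(_ 3 isT)|H]; first exact: gamma_add_path3.
apply/gt_pa => k k3; case: H => H; [|exact: good_add_path|].
  by apply: pair_critical_add_path => //; lia.
apply: (leq_trans (gamma_add_path_swap uv k)).
by apply: good_add_path; rewrite // eq_sym.
Qed.

(** * Critical pairs and edgeless graphs *)

Lemma pair_critical_no_common_neighbour (G : sgraph) (u v w : G) :
  u != v -> pair_critical u v -> adj u w -> ~~ adj v w.
Proof.
move=> uv /(pair_criticalP uv)[A [_ _ covA cardA]] uw; apply/negP => vw.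
suff : gamma G <= #|w |: A| by rewrite cardsU1; lia.
apply: gamma_covered => x; have [->|xu] := eqVneq x u.
  by apply/coveredP; right; exists w; rewrite ?setU11.
have [->|xv] := eqVneq x v.
  by apply/coveredP; right; exists w; rewrite ?setU11.
by apply: coveredS (covA x xu xv); rewrite subsetUr.
Qed.

Lemma all_pair_critical_edgeless (G : sgraph) : ~~ complete G ->
  (forall u v : G, nonadjacent u v -> pair_critical u v) -> edgeless G.
Proof.
case/noncompleteP => -[a b] /= ab crit.
apply/forallP => x; apply/forallP => y; apply/negP => xy.
have no_common (u v w : G) : nonadjacent u v -> adj u w -> adj v w -> False.
  move=> uv uw; apply/negP; case/andP: (uv) => neq _.
  exact: pair_critical_no_common_neighbour (crit _ _ uv) uw.
(* Either [a] or [b] serves: otherwise [x] is a common neighbour of the two, or equals one of them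
   and contradicts their nonadjacency. *)
have [v xv] : exists v, nonadjacent x v.
  have [xa|] := boolP (nonadjacent x a); first by exists a.
  have [xb|] := boolP (nonadjacent x b); first by exists b.
  rewrite !negb_and !negbK => /orP[/eqP xb|xb] /orP[/eqP xa|xa].
  - by case/andP: ab => /negP[]; rewrite -xa -xb.
  - by case/andP: ab => _ /negP[]; rewrite -xb adj_sym.
  - by case/andP: ab => _ /negP[]; rewrite -xa.
  by case: (no_common _ _ x ab); rewrite adj_sym.
have xv_neq : x != v by case/andP: xv.
have /(pair_criticalP xv_neq)[A [xA vA covA cardA]] := crit _ _ xv.
(* Otherwise adding [v] alone to [A] would dominate [G] with fewer than [gamma G] vertices. *)
have ncx : ~~ covered A x.
  apply/negP => cx; have := gamma_covered2 covA; rewrite cx /=; lia.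
have yx : y != x by apply/eqP => E; rewrite E adj_irrefl in xy.
have yv : y != v by apply/eqP => E; case/andP: xv => _; rewrite -E xy.
have /coveredP[yA|[s sA ys]] := covA y yx yv.
  by case/coveredP: ncx; right; exists y.
apply: (no_common x s y) => //; last by rewrite adj_sym.
apply/andP; split; first by apply/eqP => E; rewrite E sA in xA.
by apply: contra ncx => xs; apply/coveredP; right; exists s.
Qed.

(** Without edges, only the full vertex set dominates. *)
Lemma edgeless_pair_critical (G : sgraph) (u v : G) :
  edgeless G -> u != v -> pair_critical u v.
Proof.
move=> /forallP edgG uv; apply/(pair_criticalP uv).
have noadj (x y : G) : adj x y = false by apply/negbTE; move/forallP: (edgG x).
have ncov (A : {set G}) x : covered A x -> x \in A.
  by case/coveredP => // -[y _]; rewrite noadj.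
exists (~: [set u; v]); split; rewrite ?inE ?eqxx ?orbT //.
  by move=> x xu xv; apply: covered_mem; rewrite !inE (negPf xu).
have [D /forallP domD <-] := gamma_attained G.
have -> : D = setT by apply/setP => x; rewrite inE; exact/ncov/domD.
rewrite cardsT -(cardsC [set u; v]) cards2 uv; lia.
Qed.

(** * Extreme values over all nonadjacent pairs *)

Lemma epa_eq_Epa_eqP (G : sgraph) m : ~~ complete G ->
  epa G = m /\ Epa G = m <-> (forall u v : G, nonadjacent u v -> pa u v = m).
Proof.
move=> ncG; split=> [[em Em] u v uv|H].
  by have := epa_min uv; have := Epa_max uv; lia.
have [[u v] uv ->] := Epa_attained ncG; have [[u' v'] uv' ->] := epa_attained ncG.
by rewrite !H.
Qed.

Theorem corollary22 (G : sgraph) (ncG : ~~ complete G) :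
  [/\ epa G <= Epa G <= 5,
      Epa G = 5 <->
        (exists u v : G, nonadjacent u v /\ gamma (del [set u; v]) + 2 = gamma G),
      epa G = 5 <-> edgeless G
    & (epa G = 4 /\ Epa G = 4) <->
        (forall u v : G, nonadjacent u v ->
           gamma G <= gamma (del [set u; v]) + 1 /\
           ((u \in Vminus G /\ gamma_good_del [set u] v) \/
            (v \in Vminus G /\ gamma_good_del [set v] u)))].

Proof.
have epa_le : epa G <= Epa G.
  by have [[u v] uv ->] := epa_attained ncG; apply: Epa_max.
have Epa_le : Epa G <= 5.
  by have [[u v] /andP[uv _] ->] := Epa_attained ncG; apply: pa_le5.
split; first by rewrite epa_le.
- split=> [Epa5|[u [v [uv /pa_eq5P crit]]]].
    have [[u v] uv E] := Epa_attained ncG; exists u, v; split=> //.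
    by apply/pa_eq5P; [case/andP: uv|rewrite -E].
  have /crit pa5 : u != v by case/andP: uv.
  by have := Epa_max uv; lia.
- have [H1 H2] := epa_eq_Epa_eqP 5 ncG; split=> [epa5|edgG].
    apply: all_pair_critical_edgeless => // u v uv; apply/pa_eq5P; first by case/andP: uv.
    by apply: H1 => //; lia.
  suff [] : epa G = 5 /\ Epa G = 5 by [].
  apply: H2 => u v /andP[uv _]; apply/pa_eq5P => //.
  exact: edgeless_pair_critical.
apply: (iff_trans (epa_eq_Epa_eqP 4 ncG)).
split=> H u v uv; have := H u v uv; have /andP[neq _] := uv.
  move=> pa4; have : 3 < pa u v by rewrite pa4.
  (* A critical pair would give 5; since gamma drops by at most two, excluding that drop leaves at
     most one. *)
  have ncrit : ~ pair_critical u v by move/(pa_eq5P neq); rewrite pa4.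
  case/(gt3_paP neq) => // ab; split; try by [left|right].
    by have := gamma_del2_ge neq; rewrite /pair_critical in ncrit; lia.
  by have := gamma_del2_ge neq; rewrite /pair_critical in ncrit; lia.
case=> le ab; have ncrit : pa u v <> 5.
  by move/(pa_eq5P neq); rewrite /pair_critical; lia.
have : 3 < pa u v by apply/(gt3_paP neq); case: ab => ab; [apply: Or32|apply: Or33].
by have := pa_le5 neq; lia.
Qed.
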